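(* Let $n,k$ be integers with $1\le k\le n-1$ and let $G\in\mathbb{E}_n^k$, i.e. $G$ is a connected simple graph with $n$ vertices and edge connectivity $\kappa'(G)\le k$. Then $$\prod\nolimits_1(G)\le k^2\,(n-1)^{2k}\,(n-2)^{2(n-k-1)}\quad\text{and}\quad \prod\nolimits_2(G)\le k^k\,(n-1)^{k(n-1)}\,(n-2)^{(n-2)(n-k-1)},$$ and in each of the two inequalities equality holds if and only if $G\cong K_n^k$.
   Context: All graphs are finite, simple and connected. $d(u)$ is the degree of a vertex $u$. The first and second multiplicative Zagreb indices are $\prod_1(G)=\prod_{u\in V(G)}d(u)^2$ and $\prod_2(G)=\prod_{uv\in E(G)}d(u)d(v)=\prod_{u\in V(G)}d(u)^{d(u)}$. The convention $0^0=1$ is used. A graph is $k$-edge-connected ($k\ge1$) if it has at least two vertices and has no edge cut of size $k-1$; $\kappa'(G)$ is the largest $k$ for which $G$ is $k$-edge-connected. $\mathbb{E}_n^k$ is the set of connected graphs with $n$ vertices and $\kappa'(G)\le k\le n-1$. $K_n^k$ is the graph obtained from the complete graph $K_{n-1}$ by adding one new vertex and joining it to exactly $k$ vertices of $K_{n-1}$. *)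

(* Defs.v *)
From HB Require Import structures.
From mathcomp Require Import all_boot.

Set Implicit Arguments.
Unset Strict Implicit.
Unset Printing Implicit Defensive.

Record sgraph (V : finType) := SGraph {
  adj : rel V;
  adj_sym : symmetric adj;
  adj_irrefl : irreflexive adj }.

Section Graph.
Variables (V : finType) (G : sgraph V).

Definition deg (u : V) : nat := #|[set v | adj G u v]|.

(* The edge uv is the two-element set [set u; v]. *)
Definition edges : {set {set V}} :=
  [set [set p.1; p.2] | p in [set p : V * V | adj G p.1 p.2]].

Definition zagreb1 : nat := \prod_(u : V) deg u ^ 2.

(* The inner product over the two ends of e = uv is d(u)d(v). *)
Definition zagreb2 : nat := \prod_(e in edges) \prod_(u in e) deg u.

Definition connected : bool := [forall x, forall y, connect (adj G) x y].

End Graph.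

Section EdgeConnectivity.
Variables (V : finType) (G : sgraph V).

Section Delete.
Variable F : {set {set V}}.

Definition del_adj : rel V := fun x y => adj G x y && ([set x; y] \notin F).

Lemma del_adj_sym : symmetric del_adj.
Proof. by move=> x y; rewrite /del_adj adj_sym setUC. Qed.

Lemma del_adj_irrefl : irreflexive del_adj.
Proof. by move=> x; rewrite /del_adj adj_irrefl. Qed.

Definition del_edges : sgraph V := SGraph del_adj_sym del_adj_irrefl.

End Delete.

Definition edge_cut (F : {set {set V}}) : bool :=
  (F \subset edges G) && ~~ connected (del_edges F).

(* "No edge cut of size k - 1" is read as "no edge cut of size at most k - 1":
   with exact size the condition would hold vacuously once k - 1 > #|E(G)|, and
   there would be no largest k.  The two agree for k - 1 <= #|E(G)|, because a
   set of edges containing an edge cut is an edge cut. *)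
Definition k_edge_connected (k : nat) : bool :=
  [&& 1 <= k, 2 <= #|V| &
      [forall F : {set {set V}}, edge_cut F ==> ~~ (#|F| <= k - 1)]].

(* The range of the maximum is no restriction, by k_edge_connected_bound.  The
   value is 0 when no k >= 1 qualifies, i.e. for disconnected graphs and for
   graphs with fewer than two vertices. *)
Definition edge_connectivity : nat :=
  \max_(k < #|edges G|.+1 | k_edge_connected k) k.

Lemma k_edge_connected_bound (k : nat) :
  k_edge_connected k -> k <= #|edges G|.
Proof.
case/and3P=> k_gt0 /card_gt1P[x [y [_ _ neq_xy]]] /forallP/(_ (edges G)).
suff -> : edge_cut (edges G) by rewrite /= -ltnNge subn1 prednK.
rewrite /edge_cut subxx; apply/negP=> /forallP/(_ x)/forallP/(_ y).
case/connectP=> [[|z p] /= pth yE]; first by rewrite yE eqxx in neq_xy.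
case/andP: pth => /andP[xz]; suff -> : [set x; z] \in edges G by [].
by apply/imsetP; exists (x, z); rewrite ?inE.
Qed.

Lemma k_edge_connected_le (k : nat) :
  k_edge_connected k -> k <= edge_connectivity.
Proof.
move=> kG; have ltk : k < #|edges G|.+1 by rewrite ltnS k_edge_connected_bound.
exact: (@leq_bigmax_cond _ _ (fun i : 'I__ => i : nat) (Ordinal ltk)).
Qed.

End EdgeConnectivity.

Definition Enk (n k : nat) (V : finType) (G : sgraph V) : Prop :=
  [/\ #|V| = n, connected G & edge_connectivity G <= k <= n - 1].

Definition isomorphic (V W : finType) (G : sgraph V) (H : sgraph W) : Prop :=
  exists2 f : V -> W, bijective f & forall x y, adj H (f x) (f y) = adj G x y.

Section Knk.
Variables n k : nat.

(* Some i ranges over the vertices of the complete graph on n - 1 vertices; None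
   is the new vertex, joined to the first k of them (exactly k if k <= n - 1). *)
Definition Knk_adj : rel (option 'I_(n - 1)) := fun x y =>
  match x, y with
  | Some i, Some j => i != j
  | None, Some i | Some i, None => i < k
  | None, None => false
  end.

Lemma Knk_adj_sym : symmetric Knk_adj.
Proof. by move=> [i|] [j|] //=; rewrite eq_sym. Qed.

Lemma Knk_adj_irrefl : irreflexive Knk_adj.
Proof. by move=> [i|] //=; rewrite eqxx. Qed.

Definition Knk : sgraph (option 'I_(n - 1)) :=
  SGraph Knk_adj_sym Knk_adj_irrefl.

End Knk.

(* Main.v *)
(** Both indices have the form prod_u f(d(u)), with f(x) = x^2 or f(x) = x^x.  Let
    A be one side of an edge cut of size at most k.  If some vertex u has degree
    d <= k, the d neighbours of u have degree at most n - 1 and the other vertices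
    at most n - 2, and the resulting bound increases strictly with d; equality
    forces d = k and G - u complete.  If all degrees exceed k, both sides of the
    cut have at least k + 2 vertices, and the inequality is strict: on the smaller
    side, at least |A| - k >= 2 vertices are not incident to the cut and have
    degree at most |A| - 1 <= (n - 2) / 2, while all degrees are at most n - 3. *)

Require Import Defs.
From HB Require Import structures.
From mathcomp Require Import all_boot.
From mathcomp Require Import zify.

Set Implicit Arguments.
Unset Strict Implicit.
Unset Printing Implicit Defensive.

Lemma ltn_prod (I : finType) (P : pred I) (E1 E2 : I -> nat) (i0 : I) :
  P i0 -> (forall i, P i -> 0 < E1 i <= E2 i) -> E1 i0 < E2 i0 ->
  \prod_(i | P i) E1 i < \prod_(i | P i) E2 i.
Proof.
move=> Pi0 le12 lt12; rewrite (bigD1 i0) //= [ltnRHS](bigD1 i0) //=.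
have le' : \prod_(i | P i && (i != i0)) E1 i <= \prod_(i | P i && (i != i0)) E2 i.
  by apply: leq_prod => i /andP[/le12/andP[]].
have gt0 : 0 < \prod_(i | P i && (i != i0)) E1 i.
  by apply: prodn_cond_gt0 => i /andP[/le12/andP[]].
by apply: leq_ltn_trans (leq_mul (leqnn _) le') _; rewrite ltn_mul2r lt12 (leq_trans gt0).
Qed.

(** * Degrees and edge cuts *)

Section Cuts.
Variables (V : finType) (G : sgraph V).
Implicit Types (A : {set V}) (u v : V).

Definition out_deg A u : nat := \sum_(v in ~: A) (adj G u v : nat).
Definition cut A : nat := \sum_(u in A) out_deg A u.
Definition interior A : {set V} := [set u in A | out_deg A u == 0].

Lemma cutC A : cut (~: A) = cut A.
Proof.
rewrite /cut /out_deg exchange_big setCK.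
by apply: eq_bigr => u _; apply: eq_bigr => v _; rewrite adj_sym.
Qed.

(** Since [u] is not its own neighbour, at most [#|A| - 1] of its neighbours lie in [A]. *)
Lemma deg_lt_out_deg A u : u \in A -> deg G u < #|A| + out_deg A u.
Proof.
move=> Au; have -> : deg G u = \sum_v (adj G u v : nat).
  by rewrite /deg -sum1dep_card big_mkcond; apply: eq_bigr => v _; case: adj.
rewrite (bigID (mem A)) /=.
have -> : \sum_(v | v \notin A) (adj G u v : nat) = out_deg A u.
  by apply: eq_bigl => v; rewrite inE.
rewrite ltn_add2r (bigD1 u) //= adj_irrefl add0n (cardsD1 u) Au add1n ltnS.
rewrite -sum1_card [leqRHS](eq_bigl (fun v => (v \in A) && (v != u))).
  by apply: leq_sum => v _; case: adj.
by move=> v; rewrite !inE andbC.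
Qed.

Lemma out_deg_le_cut A u : u \in A -> out_deg A u <= cut A.
Proof. by move=> Au; rewrite /cut (bigD1 u) //= leq_addr. Qed.

Lemma deg_lt_card u : deg G u < #|V|.
Proof.
have := deg_lt_out_deg (in_setT u).
by rewrite /out_deg setCT big_set0 addn0 cardsT.
Qed.

(** Each vertex of [A] outside the interior contributes at least 1 to [cut A]. *)
Lemma card_le_interior A : #|A| <= #|interior A| + cut A.
Proof.
rewrite -[#|interior A|]sum1dep_card -sum1_card big_mkcondr -big_split /=.
by apply: leq_sum => u _; case: (out_deg A u).
Qed.

(** If [A] had a vertices with 1 <= a <= k + 1, each would send at least k + 2 - a edges out, and
    a(k + 2 - a) >= k + 1 exceeds the cut. *)
Lemma cut_card_gt A k u : u \in A -> cut A <= k -> (forall v, k < deg G v) ->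
  k.+1 < #|A|.
Proof.
move=> Au cutk degk; rewrite ltnNge; apply/negP => leAk.
have A0 : 0 < #|A| by apply/card_gt0P; exists u.
have : \sum_(v in A) (k.+2 - #|A|) <= cut A.
  apply: leq_sum => v Av; have := deg_lt_out_deg Av; have := degk v; lia.
rewrite sum_nat_const; nia.
Qed.

Lemma connected_deg_gt0 u : connected G -> 1 < #|V| -> 0 < deg G u.
Proof.
move=> /forallP/(_ u)/forallP conn; rewrite (cardD1 u) inE add1n ltnS.
case/card_gt0P=> v; rewrite !inE andbT => vu.
case/connectP: (conn v) => [[|w p] /= pth vE]; first by rewrite vE eqxx in vu.
by apply/card_gt0P; exists w; rewrite inE; case/andP: pth.
Qed.

(** Some set [F] of at most k edges separates x from y. With [A] the component of x after deleting
    [F], every edge leaving [A] belongs to [F]. *)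
Lemma edge_connectivity_cut k : 1 < #|V| -> edge_connectivity G <= k ->
  exists A x y, [/\ x \in A, y \notin A & cut A <= k].
Proof.
move=> V1 leGk.
have /negP : ~~ k_edge_connected G k.+1.
  by apply: contraL leGk => /k_edge_connected_le; rewrite -ltnNge.
rewrite /k_edge_connected V1 /= subn1 /= => /negP/forallPn[F].
rewrite negb_imply negbK => /andP[/andP[_ /forallPn[x /forallPn[y ncxy]]] leFk].
pose A := [set z | connect (del_adj G F) x z].
exists A, x, y; rewrite !inE connect0; split=> //.
apply: leq_trans leFk.
pose P := [set p : V * V | [&& p.1 \in A, p.2 \in ~: A & adj G p.1 p.2]].
have -> : cut A = #|P|.
  rewrite /cut /out_deg pair_big_dep -sum1dep_card big_mkcond [RHS]big_mkcond /=.
  apply: eq_bigr => p _; case: (p.1 \in A) => //=.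
  by case: (p.2 \in ~: A) => //=; case: adj.
(* The end lying in [A] recovers the orientation of a cut edge. *)
have injP : {in P &, injective (fun p => [set p.1; p.2])}.
  move=> [a b] [c d]; rewrite !inE /= => /and3P[Aa Ab _] /and3P[Ac Ad _] eq2.
  have: a \in [set c; d] by rewrite -eq2 !inE eqxx.
  have: b \in [set c; d] by rewrite -eq2 !inE eqxx orbT.
  rewrite !inE => /orP[] /eqP bE /orP[] /eqP aE; rewrite aE bE // in Aa Ab *.
  - by rewrite Aa in Ab.
  - by rewrite Ac in Ab.
  - by rewrite Aa in Ad.
rewrite -(card_in_imset injP); apply/subset_leq_card/subsetP => e.
case/imsetP=> [[a b]]; rewrite !inE /= => /and3P[Aa Ab ab] ->.
apply: contraR Ab => Fab; apply: connect_trans Aa (connect1 _).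
by rewrite /del_adj ab.
Qed.

End Cuts.

(** * Graphs that are complete away from one vertex *)

(* Equivalent, by a degree count, to G - u being complete. *)
Definition complete_off (V : finType) (G : sgraph V) (u : V) : Prop :=
  forall v, v != u -> deg G v = #|V| - 2 + adj G u v.

Lemma complete_off_adj (V : finType) (G : sgraph V) (u : V) :
  complete_off G u -> forall v w, v != u -> w != u -> adj G v w = (v != w).
Proof.
move=> pcG v w vu wu; have [->|vw] := eqVneq v w; first exact: adj_irrefl.
apply/negPn/negP => nvw; have := pcG v vu.
(* If [v] misses [w], its neighbours fit in a set one element smaller than the prescribed degree. *)
have: [set z | adj G v z] \subset
    (if adj G u v then [set~ v] :\ w else [set~ v] :\ w :\ u).
  apply/subsetP => z; rewrite inE => vz.
  have zv : z != v by apply: contraTneq vz => ->; rewrite adj_irrefl.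
  have zw : z != w by apply: contraTneq vz => ->.
  case: ifP => uv; rewrite !inE zv zw //= andbT.
  by apply: contraTneq vz => ->; rewrite adj_sym uv.
move/subset_leq_card; rewrite -/(deg G v).
have cv : #|[set~ v]| = #|V| - 1 by rewrite cardsC1 subn1.
have := cardsD1 w [set~ v]; rewrite !inE eq_sym vw cv.
have := cardsD1 u ([set~ v] :\ w); rewrite !inE (eq_sym u v) (eq_sym u w) vu wu.
have : 1 < #|V| by apply/card_gt1P; exists v, w.
case: (adj G u v) => /=; lia.
Qed.

(** Send [u] to [None] and number the other vertices with the neighbours of [u] first; index below
    [deg G u] then means adjacency to [u], as in [Knk]. *)
Lemma complete_off_iso n (V : finType) (G : sgraph V) (u : V) :
  #|V| = n -> complete_off G u -> isomorphic G (Knk n (deg G u)).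
Proof.
move=> Vn pcG; pose N := [set v | adj G u v].
pose s := enum N ++ enum ((~: N) :\ u).
have Nu : u \notin N by rewrite inE adj_irrefl.
have mem_s v : (v \in s) = (v != u).
  rewrite mem_cat !mem_enum !inE; have [->|_] := eqVneq v u; rewrite ?adj_irrefl //.
  by rewrite andTb orbN.
have size_s : size s = n - 1.
  rewrite size_cat -!cardE; have := cardsD1 u (~: N); rewrite inE Nu.
  have := cardsC N; rewrite Vn; lia.
have lt_s v : v != u -> index v s < n - 1 by rewrite -mem_s -size_s index_mem.
pose f v : option 'I_(n - 1) := if v == u then None else insub (index v s).
have fE v (vu : v != u) : f v = Some (Ordinal (lt_s v vu)).
  by rewrite /f (negPf vu); apply: insubT.
have fu : f u = None by rewrite /f eqxx.
have indexN v : (index v s < deg G u) = adj G u v.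
  rewrite index_cat mem_enum inE [deg G u]cardE -/N.
  case: ifPn => uv; first by rewrite index_mem mem_enum inE.
  by rewrite ltnNge leq_addr.
have injf : injective f.
  move=> v w; have [->|vu] := eqVneq v u; have [->|wu] := eqVneq w u => //.
  - by rewrite fu (fE w wu).
  - by rewrite fu (fE v vu).
  rewrite (fE v vu) (fE w wu) => -[] /(congr1 (nth u s)).
  by rewrite !nth_index ?mem_s.
have n0 : 0 < n by rewrite -Vn; apply/card_gt0P; exists u.
exists f.
  by apply: inj_card_bij injf _; rewrite card_option card_ord Vn subn1 prednK.
move=> v w; have [->|vu] := eqVneq v u; have [->|wu] := eqVneq w u.
- by rewrite !adj_irrefl.
- by rewrite fu (fE w wu) /= indexN.
- by rewrite fu (fE v vu) /= indexN adj_sym.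
by rewrite (complete_off_adj pcG) // -(inj_eq injf v w) (fE v vu) (fE w wu).
Qed.

Lemma deg_Knk_None n k : k <= n - 1 -> deg (Knk n k) None = k.
Proof.
move=> lekn; rewrite /deg.
have -> : [set v | adj (Knk n k) None v] = [set Some (widen_ord lekn i) | i : 'I_k].
  apply/setP=> [[i|]]; rewrite inE /=; last first.
    by apply/esym/negP => /imsetP[].
  apply/idP/imsetP => [ik|[j _ [->]]] /=; last exact: ltn_ord.
  by exists (Ordinal ik) => //; congr Some; apply: val_inj.
rewrite card_imset ?card_ord // => i j [ij].
exact: val_inj.
Qed.

Lemma complete_off_Knk n k : k <= n - 1 -> complete_off (Knk n k) None.
Proof.
move=> lekn [i|//] _; rewrite card_option card_ord.
have -> : adj (Knk n k) None (Some i) = (i < k) by [].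
have lti := ltn_ord i.
have -> : deg (Knk n k) (Some i) =
    #|if i < k then [set~ Some i] else [set~ Some i] :\ None|.
  apply: eq_card => -[j|]; case: ifP => ik; rewrite !inE /= ?ik //;
    by rewrite (inj_eq (@Some_inj _)) eq_sym.
have := cardsC1 (Some i); have := cardsD1 None [set~ Some i].
rewrite card_option card_ord !inE /=; case: ifP => _ /=; lia.
Qed.

(** * Bounds for weighted degree products *)

(* The last condition says that j vertices of degree p can be traded for one of
   degree k and j - 1 of degree m. *)
Definition zagreb_weight (f : nat -> nat) : Prop :=
  [/\ forall x, 0 < x -> 0 < f x,
      forall x y, 0 < x -> x < y -> f x < f y
    & forall k j p m, 0 < k -> 1 < j -> 0 < p < j + k -> 2 * p <= m ->
        f p ^ j <= f k * f m ^ j.-1].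

(** The factors follow the degrees in [Knk n k] for [k <= n - 1]: k at [None], n - 1 at its k
    neighbours, n - 2 at the other n - k - 1 vertices. *)
Definition extremal_value (f : nat -> nat) (n k : nat) : nat :=
  f k * f (n - 1) ^ k * f (n - 2) ^ (n - k - 1).

Section Weights.
Variables (f : nat -> nat) (n : nat) (V : finType) (G : sgraph V).

(** The left side depends only on the neighbourhood of [u], so the formula serves both as an upper
    bound for general [G] and as the exact product under [complete_off G u]. *)
Lemma prod_complete_off_weight u : #|V| = n ->
  \prod_(v | v != u) f (n - 2 + adj G u v) =
    f (n - 1) ^ deg G u * f (n - 2) ^ (n - deg G u - 1).
Proof.
move=> Vn; have Nu : u \notin [set v | adj G u v] by rewrite inE adj_irrefl.
have := deg_lt_card G u; rewrite Vn => ltun.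
rewrite (bigID (adj G u)) /=; congr (_ * _).
  rewrite (eq_bigr (fun=> f (n - 1))) => [|v /andP[_ uv]]; last first.
    (* A neighbour of [u] forces [2 <= n], so the truncated [n - 2 + 1] is [n - 1]. *)
    have : 0 < deg G u by apply/card_gt0P; exists v; rewrite inE.
    by rewrite uv => ?; congr f; lia.
  rewrite -[RHS]prod_nat_const; apply: eq_bigl => v.
  by rewrite inE; case: (eqVneq v u) => [->|//]; rewrite adj_irrefl.
rewrite (eq_bigr (fun=> f (n - 2))); last first.
  by move=> v /andP[_ /negPf->]; rewrite addn0.
have -> : n - deg G u - 1 = #|(~: [set v | adj G u v]) :\ u|.
  have := cardsD1 u (~: [set v | adj G u v]); rewrite inE Nu.
  have := cardsC [set v | adj G u v]; rewrite Vn -/(deg G u); lia.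
by rewrite -prod_nat_const; apply: eq_bigl => v; rewrite !inE.
Qed.

Lemma prod_complete_off u : #|V| = n -> complete_off G u ->
  \prod_v f (deg G v) = extremal_value f n (deg G u).
Proof.
move=> Vn pcG; rewrite (bigD1 u) //= /extremal_value -mulnA; congr (_ * _).
rewrite -(prod_complete_off_weight u Vn); apply: eq_bigr => v vu.
by rewrite pcG ?Vn.
Qed.

Hypothesis fW : zagreb_weight f.

Lemma weight_gt0 x : 0 < x -> 0 < f x.
Proof. by case: fW => + _ _; apply. Qed.

Lemma weight_lt x y : 0 < x -> x < y -> f x < f y.
Proof. by case: fW => _ + _; apply. Qed.

Lemma weight_le x y : 0 < x -> x <= y -> f x <= f y.
Proof.
by move=> x0; rewrite leq_eqVlt => /predU1P[->//|/(weight_lt x0)/ltnW].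
Qed.

(** Passing from d to k turns k - d factors [f (n - 2)] into [f (n - 1)], which loses nothing, and
    raises [f d] strictly to [f k]. *)
Lemma extremal_value_lt d k : 0 < d -> d < k -> k < n ->
  extremal_value f n d < extremal_value f n k.
Proof.
move=> d0 dk kn; rewrite /extremal_value -!mulnA.
have f1 : 0 < f (n - 1) by apply: weight_gt0; lia.
have f2 : 0 < f (n - 2) by apply: weight_gt0; lia.
have -> : n - d - 1 = (k - d) + (n - k - 1) by lia.
have -> : f (n - 1) ^ k = f (n - 1) ^ d * f (n - 1) ^ (k - d).
  by rewrite -expnD; congr (_ ^ _); lia.
rewrite expnD -!mulnA.
have le12 : f (n - 2) ^ (k - d) <= f (n - 1) ^ (k - d).
  by rewrite leq_exp2r; [apply: weight_le; lia | lia].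
apply: (@leq_ltn_trans
    (f d * (f (n - 1) ^ d * (f (n - 1) ^ (k - d) * f (n - 2) ^ (n - k - 1))))).
  by rewrite !leq_mul.
by rewrite ltn_mul2r weight_lt // !muln_gt0 !expn_gt0 f1 f2.
Qed.

(** Strictness comes either from [deg G u < k], by monotonicity of [extremal_value], or from a
    vertex below its maximal degree; if both fail, the second alternative holds. *)
Lemma low_degree_vertex k u : #|V| = n -> 1 <= k <= n - 1 ->
  (forall v, 0 < deg G v) -> deg G u <= k ->
  \prod_v f (deg G v) < extremal_value f n k \/
  complete_off G u /\ deg G u = k.
Proof.
move=> Vn /andP[k1 kn] deg0 duk.
have le_deg v : v != u -> deg G v <= n - 2 + adj G u v.
  move=> vu; have := deg_lt_card G v; rewrite Vn.
  case uv: (adj G u v) => /=; first lia.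
  (* A non-neighbour of [u] sends no edge out of [[set~ u]], a set of n - 1 vertices. *)
  have vA : v \in [set~ u] by rewrite !inE.
  have := deg_lt_out_deg G vA; rewrite /out_deg setCK big_set1 adj_sym uv cardsC1 Vn.
  lia.
have leE v : v != u -> 0 < f (deg G v) <= f (n - 2 + adj G u v).
  by move=> vu; rewrite weight_gt0 ?weight_le ?deg0 ?le_deg.
have leP : \prod_v f (deg G v) <= extremal_value f n (deg G u).
  rewrite (bigD1 u) //= /extremal_value -mulnA -(prod_complete_off_weight u Vn).
  by rewrite leq_mul // leq_prod // => v /leE/andP[].
move: duk; rewrite leq_eqVlt => /predU1P[duk|ltduk]; last first.
  by left; apply: leq_ltn_trans leP _; apply: extremal_value_lt => //; lia.
have [/forallP pcG|/forallPn[v]] :=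
  boolP [forall v, (v != u) ==> (deg G v == n - 2 + adj G u v)].
  by right; split=> // v vu; have /implyP/(_ vu)/eqP := pcG v; rewrite Vn.
rewrite negb_imply => /andP[vu neq]; left.
rewrite (bigD1 u) //= /extremal_value -mulnA -duk -(prod_complete_off_weight u Vn).
rewrite ltn_mul2l weight_gt0 //=; apply: (@ltn_prod _ _ _ _ v) => //.
by apply: weight_lt; rewrite // ltn_neqAle neq le_deg.
Qed.

(* Counting the cut edges forces both sides to have at least k + 2 vertices, so
   all degrees are at most n - 3; the vertices of the smaller side that miss the
   cut have such small degrees that they can be traded as in [zagreb_weight]. *)
Lemma high_degree_cut k (A : {set V}) x y : #|V| = n -> 0 < k <= n - 1 ->
  x \in A -> y \notin A -> cut G A <= k -> #|A| <= #|~: A| ->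
  (forall v, k < deg G v) ->
  \prod_v f (deg G v) < extremal_value f n k.
Proof.
move=> Vn /andP[k0 kn] xA yA cutA leA degk.
have yA' : y \in ~: A by rewrite inE.
have cutA' : cut G (~: A) <= k by rewrite cutC.
have gtA := cut_card_gt xA cutA degk.
have gtA' := cut_card_gt yA' cutA' degk.
have sumA := cardsC A; rewrite Vn in sumA.
set U := interior G A.
have leU : #|A| <= #|U| + k by apply: leq_trans (card_le_interior G A) _; rewrite leq_add2l.
have degU v : v \in U -> deg G v <= #|A| - 1.
  by rewrite inE => /andP[vA /eqP o0]; have := deg_lt_out_deg G vA; rewrite o0; lia.
(* The side containing [v] has at most n - k - 2 vertices, and at most k edges leave it. *)
have deg3 v : deg G v <= n - 3.
  have [vA|vA] := boolP (v \in A).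
    by have := deg_lt_out_deg G vA; have := out_deg_le_cut G vA; lia.
  have vA' : v \in ~: A by rewrite inE.
  by have := deg_lt_out_deg G vA'; have := out_deg_le_cut G vA'; lia.
have ltU : #|U| < n.
  have : #|U| <= #|A| by apply/subset_leq_card/subsetP => v; rewrite inE => /andP[].
  lia.
have f1 : 0 < f (#|A| - 1) by apply: weight_gt0; lia.
have f3 : 0 < f (n - 3) by apply: weight_gt0; lia.
have f23 : f (n - 3) < f (n - 2) by apply: weight_lt; lia.
have le1 : \prod_v f (deg G v) <= f (#|A| - 1) ^ #|U| * f (n - 3) ^ (n - #|U|).
  rewrite (bigID (mem U)) /= leq_mul //.
    by rewrite -prod_nat_const leq_prod // => v /degU; apply: weight_le; have := degk v; lia.
  have -> : n - #|U| = #|~: U| by rewrite -Vn -(cardsC U) addKn.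
  rewrite -prod_nat_const [leqRHS](eq_bigl (fun v => v \notin U)) => [|v]; last by rewrite inE.
  by rewrite leq_prod // => v _; apply: weight_le; have := degk v; rewrite ?deg3 //; lia.
(* Strictness arises here: some vertex lies outside [U], and its weight is raised from [f (n - 3)]
   to [f (n - 2)]. *)
have lt2 : f (#|A| - 1) ^ #|U| * f (n - 3) ^ (n - #|U|) <
    f (#|A| - 1) ^ #|U| * f (n - 2) ^ (n - #|U|).
  by rewrite ltn_mul2l expn_gt0 f1 ltn_exp2r ?subn_gt0.
apply: leq_ltn_trans le1 (leq_trans lt2 _).
(* The trade with j = [#|U|] >= 2, p = [#|A| - 1] and m = n - 2; 2p <= m because [A] is the smaller
   side. *)
have le3 : f (#|A| - 1) ^ #|U| <= f k * f (n - 2) ^ #|U|.-1.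
  case: fW => _ _; apply=> //; lia.
apply: leq_trans (leq_mul le3 (leqnn _)) _.
rewrite /extremal_value -!mulnA leq_mul2l -expnD; apply/orP; right.
(* Of the n - 1 factors [f (n - 2)] now present, k are raised to [f (n - 1)]. *)
have -> : #|U|.-1 + (n - #|U|) = k + (n - k - 1) by lia.
rewrite expnD leq_mul2r leq_exp2r //; apply/orP; right.
by apply: weight_le; lia.
Qed.

End Weights.

(** * The bound and its equality case for a general weight *)

Lemma isomorphic_prod_deg (f : nat -> nat) (V W : finType) (G : sgraph V) (H : sgraph W) :
  isomorphic G H -> \prod_v f (deg G v) = \prod_w f (deg H w).
Proof.
case=> h hbij hadj; rewrite [RHS](reindex h) /=; last exact: onW_bij.
apply: eq_bigr => v _; congr f; rewrite /deg.
rewrite -(on_card_preimset (f := h)); last exact: onW_bij.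
by apply: eq_card => w; rewrite !inE hadj.
Qed.

(** Isomorphic graphs have equal products, so both claims follow once [G] is either isomorphic to
    [Knk n k] or strictly below the bound. *)
Lemma prod_deg_extremal (f : nat -> nat) n k (V : finType) (G : sgraph V) :
  zagreb_weight f -> 1 <= k <= n - 1 -> Enk n k G ->
  \prod_v f (deg G v) <= extremal_value f n k /\
  (\prod_v f (deg G v) = extremal_value f n k <-> isomorphic G (Knk n k)).
Proof.
move=> fW hk [Vn conn /andP[leGk _]].
have V1 : 1 < #|V| by rewrite Vn; lia.
have deg0 v : 0 < deg G v by apply: connected_deg_gt0.
have iso_eq : isomorphic G (Knk n k) -> \prod_v f (deg G v) = extremal_value f n k.
  move/(isomorphic_prod_deg f) => ->; case/andP: hk => k1 kn.
  rewrite (prod_complete_off f (n := n) (u := None)) ?deg_Knk_None //.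
    by rewrite card_option card_ord; lia.
  exact: complete_off_Knk.
have [iso|lt] : isomorphic G (Knk n k) \/ \prod_v f (deg G v) < extremal_value f n k.
- have [/existsP[u duk]|/existsPn degk] := boolP [exists u, deg G u <= k].
    have [|[pcG <-]] := low_degree_vertex fW Vn hk deg0 duk; first by right.
    by left; apply: complete_off_iso.
  right; have {}degk v : k < deg G v by rewrite ltnNge degk.
  have [A [x [y [xA yA cutA]]]] := edge_connectivity_cut V1 leGk.
  have [leA|/ltnW leA] := leqP #|A| #|~: A|.
    exact: (high_degree_cut fW Vn hk xA yA).
  by apply: (high_degree_cut fW Vn hk (A := ~: A) (x := y) (y := x));
    rewrite ?cutC ?setCK ?inE ?negbK.
- by rewrite iso_eq.
- split; first exact: ltnW.
  by split=> [eqP|/iso_eq //]; rewrite eqP ltnn in lt.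
Qed.

(** * The two Zagreb indices as weighted products *)

(** Exchanging the products, [u] contributes [deg G u] once per incident edge, and v -> {u, v}
    matches its neighbours with these edges. *)
Lemma zagreb2E (V : finType) (G : sgraph V) :
  zagreb2 G = \prod_u deg G u ^ deg G u.
Proof.
rewrite /zagreb2 (exchange_big_dep predT) //=; apply: eq_bigr => u _.
have inj_u : injective (fun v : V => [set u; v]).
  move=> v w eq_vw.
  have: v \in [set u; w] by rewrite -eq_vw !inE eqxx orbT.
  have: w \in [set u; v] by rewrite eq_vw !inE eqxx orbT.
  by rewrite !inE => /orP[] /eqP -> // /orP[] /eqP ->.
rewrite {3}/deg -(card_imset _ inj_u) -prod_nat_const; apply: eq_bigl => e.
apply/andP/imsetP => [[/imsetP[[a b]]]|[v]]; rewrite inE /=.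
  move=> ab ->; rewrite !inE => /orP[] /eqP ->; first by exists b; rewrite ?inE.
  by exists a; rewrite ?inE 1?adj_sym // setUC.
move=> uv ->; rewrite !inE eqxx; split=> //.
by apply/imsetP; exists (u, v); rewrite ?inE.
Qed.

(** After removing squares, the trade follows from p <= j + k - 1 <= kj <= k 2^(j-1) and (2p)^(j-1)
    <= m^(j-1). *)
Lemma zagreb_weight_sqr : zagreb_weight (fun x => x ^ 2).
Proof.
split=> [x x0|x y _ xy|k j p m k0 j1 /andP[p0 pjk] pm]; first by rewrite expn_gt0 x0.
  by rewrite ltn_exp2r.
rewrite -!expnM !(mulnC 2) !expnM -expnMn leq_exp2r //.
have {1}-> : j = j.-1.+1 by lia.
have : j.-1 < 2 ^ j.-1 by apply: ltn_expl.
have : (2 * p) ^ j.-1 <= m ^ j.-1 by rewrite leq_exp2r //; lia.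
rewrite expnS expnMn => le_pm lt_j.
apply: (@leq_trans (k * (2 ^ j.-1 * p ^ j.-1))); last by rewrite leq_mul2l le_pm orbT.
by rewrite mulnA leq_mul2r; apply/orP; right; nia.
Qed.

(** For the trade, j >= 2 gives pj <= 2p(j - 1) <= m(j - 1), so p^(pj) <= m^(m(j-1)) already without
    the factor k^k >= 1. *)
Lemma zagreb_weight_self_exp : zagreb_weight (fun x => x ^ x).
Proof.
split=> [x x0|x y x0 xy|k j p m k0 j1 /andP[p0 _] pm]; first by rewrite expn_gt0 x0.
  apply: (@leq_ltn_trans (x ^ y)); first by rewrite leq_pexp2l // ltnW.
  by rewrite ltn_exp2r //; lia.
apply: (@leq_trans ((m ^ m) ^ j.-1)); last by rewrite leq_pmull // expn_gt0 k0.
rewrite -!expnM; apply: (@leq_trans (p ^ (m * j.-1))); first by rewrite leq_pexp2l //; nia.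
by rewrite leq_exp2r; nia.
Qed.

Theorem theorem4p5 (n k : nat) (hk : 1 <= k <= n - 1)
    (V : finType) (G : sgraph V) (hG : Enk n k G) :
  (zagreb1 G <= k ^ 2 * (n - 1) ^ (2 * k) * (n - 2) ^ (2 * (n - k - 1))
   /\ (zagreb1 G = k ^ 2 * (n - 1) ^ (2 * k) * (n - 2) ^ (2 * (n - k - 1))
       <-> isomorphic G (Knk n k)))
  /\
  (zagreb2 G <= k ^ k * (n - 1) ^ (k * (n - 1)) * (n - 2) ^ ((n - 2) * (n - k - 1))
   /\ (zagreb2 G = k ^ k * (n - 1) ^ (k * (n - 1)) * (n - 2) ^ ((n - 2) * (n - k - 1))
       <-> isomorphic G (Knk n k))).
Proof.
have := prod_deg_extremal zagreb_weight_sqr hk hG.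
have := prod_deg_extremal zagreb_weight_self_exp hk hG.
by rewrite -zagreb2E /extremal_value -!expnM (mulnC (n - 1)).
Qed.
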